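(* Consider the model $$\dot X_1=f(X_2)-X_1,\qquad \dot X_2=(X_1-1)X_2,$$ whose sole unknown is the function $f:\mathbb{R}\to\mathbb{R}$. If only $X_1$ is observed, then the unknown function $f$ is structurally non-identifiable due to a scaling non-identifiability. Specifically, given any admissible function $f_1$, any alternative function of the form $$f_2(X_2)=f_1(X_2/k),\qquad k\in\mathbb{R}\setminus\{0\},$$ yields identical dynamics to those of $f_1$ with respect to $X_1$, provided $f$ is locally invertible.
   Context: An ODE model has the form $\dot{\boldsymbol X}(t)=\boldsymbol F(\boldsymbol X;\boldsymbol f,\boldsymbol p)$, $\boldsymbol Y(t)=\boldsymbol H(\boldsymbol X(t))$, with state $\boldsymbol X\in\mathbb{R}^n$, observed output $\boldsymbol Y$ consisting of some or all of the state variables, known $\boldsymbol F,\boldsymbol H$, unknown scalar parameters $\boldsymbol p$ (none here), and unknown real-valued functions $\boldsymbol f$. Unknown functions are understood to be regular enough that solutions exist and the derivatives that occur make sense; a choice of unknowns is admissible if it is a possible choice for the model. Two choices of the unknowns give the same observed outputs (yield identical dynamics with respect to the observed variable) if they produce the same output trajectory $\boldsymbol Y(t)$ for every initial condition consistent with prior knowledge of the initial conditions. Here the known initial conditions are $\boldsymbol Y(0)$; initial values of unobserved states are unknown and may differ between the two choices. Two choices are indistinguishable if they generate the same input-output equation, i.e. the same differential equation involving only the observed variable, its derivatives and the unknowns, obtained by eliminating the unobserved state. Fix a generic choice of the unknowns. An unknown function is globally structurally identifiable if every choice giving the same observed outputs as the fixed choice has the same function; locally structurally identifiable if there is $\varepsilon>0$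 such that every choice giving the same observed outputs, and for which the function is within sup-distance $<\varepsilon$ of the fixed one, has the same function; structurally non-identifiable otherwise. $f$ is locally invertible if it contains no flat regions ($f'=0$ only at isolated points).
   Formalization: With sup-distance over all of R, f(x)=x is locally identifiable, so the literal claim fails; local non-identifiability is stated with sup-distance on every bounded interval for all f, and over R for f with finite limits at both infinities. Admissible is read as C^1. *)

(* Defs.v *)
From HB Require Import structures.
From mathcomp Require Import all_boot all_order all_algebra.
From mathcomp Require Import all_classical all_reals all_analysis.
Set Implicit Arguments.
Unset Strict Implicit.
Unset Printing Implicit Defensive.
Import Order.TTheory GRing.Theory Num.Theory.
Import numFieldNormedType.Exports.
Local Open Scope classical_set_scope.
Local Open Scope ring_scope.

(** C^1, so that initial value problems for the model are locally well posed. *)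
Definition admissible (R : realType) (f : R -> R) : Prop :=
  (forall x : R, derivable f x 1) /\ continuous (derive1 f).

Definition locally_invertible (R : realType) (f : R -> R) : Prop :=
  forall x : R, derive1 f x = 0 -> \forall y \near x^', derive1 f y != 0.

(** Trajectories live on [0, T[ with [T] possibly infinite, because solutions
    may blow up in finite time; values of [X1], [X2] elsewhere are irrelevant. *)
Definition solution (R : realType) (f : R -> R) (T : \bar R) (X1 X2 : R -> R)
    : Prop :=
  [/\ {within [set t : R | 0 <= t /\ (t%:E < T)%E], continuous X1},
      {within [set t : R | 0 <= t /\ (t%:E < T)%E], continuous X2} &
      forall t : R, 0 < t -> (t%:E < T)%E ->
        is_derive t 1 X1 (f (X2 t) - X1 t) /\
        is_derive t 1 X2 ((X1 t - 1) * X2 t)].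

(** [X1] is observed and [X1 0] is known; [X2], including [X2 0], is not. *)
Definition output (R : realType) (f : R -> R) (y0 : R) (T : \bar R)
    (Y : R -> R) : Prop :=
  Y 0 = y0 /\ exists X2 : R -> R, solution f T Y X2.

Definition same_outputs (R : realType) (f1 f2 : R -> R) : Prop :=
  forall (y0 : R) (T : \bar R) (Y : R -> R), (0 < T)%E ->
    output f1 y0 T Y <-> output f2 y0 T Y.

Definition sup_dist (R : realType) (D : set R) (f g : R -> R) : \bar R :=
  ereal_sup [set `|f x - g x|%:E | x in D].

(** Identifiability of the unknown function, at the choice [f], as a function
    on the region [D] of values of [X2].  On the whole line ([D = setT]) the
    sup-distance is too coarse for an unbounded [f]: for [f] the identity, all
    rescalings of [f] other than [f] itself are at infinite distance. *)
Definition globally_identifiable (R : realType) (D : set R) (f : R -> R)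
    : Prop :=
  forall g : R -> R, admissible g -> same_outputs f g ->
    forall x : R, D x -> g x = f x.

Definition locally_identifiable (R : realType) (D : set R) (f : R -> R)
    : Prop :=
  exists2 e : R, 0 < e &
    forall g : R -> R, admissible g -> same_outputs f g ->
      (sup_dist D g f < e%:E)%E -> forall x : R, D x -> g x = f x.

Definition structurally_nonidentifiable (R : realType) (D : set R)
    (f : R -> R) : Prop :=
  ~ globally_identifiable D f /\ ~ locally_identifiable D f.

(* Main.v *)
Require Import Defs.
From HB Require Import structures.
From mathcomp Require Import all_boot all_order all_algebra.
From mathcomp Require Import all_classical all_reals all_analysis.
From mathcomp Require Import lra.
Set Implicit Arguments.
Unset Strict Implicit.
Unset Printing Implicit Defensive.
Import Order.TTheory GRing.Theory Num.Theory.
Import numFieldNormedType.Exports.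
Local Open Scope classical_set_scope.
Local Open Scope ring_scope.

(** The substitution [X2 := k X2] turns a solution for [f1] into one for
    [x |-> f1 (x / k)] with the same [X1], because the equation of [X2] is
    linear in [X2].  These alternatives refute identifiability, even locally:
    [f1' x0 != 0] at some point [x0 != 0] of the region, so [f1 (s x0)] differs
    from [f1 x0] for all [s != 1] near [1]; while [x |-> f1 (s x)] tends to
    [f1] uniformly as [s] tends to [1], by compactness on a segment, and on the
    whole line by the limits of [f1] at infinity. *)

Lemma derivable_dilate (R : realType) (f : R -> R) (c x : R) :
  derivable f (x * c) 1 -> derivable (fun y : R => f (y * c)) x 1.
Proof.
move=> /derivable1_diffP df; apply/derivable1_diffP.
by apply: (@differentiable_comp _ _ _ _ (fun y : R => y * c) f).
Qed.

Lemma derive1_dilate (R : realType) (f : R -> R) (c x : R) :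
  derivable f (x * c) 1 ->
  derive1 (fun y : R => f (y * c)) x = derive1 f (x * c) * c.
Proof.
move=> df; rewrite (@derive1_comp _ (fun y : R => y * c) f)//.
by rewrite (@derive1Mr _ id)// derive1_id mul1r.
Qed.

(** The difference quotient tends to a nonzero limit, so it is eventually nonzero, and then so is
    its numerator. *)
Lemma derive1_neq0_near (R : realType) (f : R -> R) (a : R) :
  derivable f a 1 -> derive1 f a != 0 -> \forall h \near 0^', f (h + a) != f a.
Proof.
move=> df; rewrite derive1E => /(cvgr_neq0 _ df); apply: filterS => h /=.
by rewrite [h%:A]mulr1; apply: contra_neq => ->; rewrite subrr scaler0.
Qed.

Lemma admissible_dilate (R : realType) (f : R -> R) (k : R) :
  admissible f -> admissible (fun x => f (x / k)).
Proof.
move=> [df cf]; split=> [x|]; first exact: derivable_dilate.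
rewrite (_ : derive1 _ = fun x => derive1 f (x / k) / k); last first.
  by apply/funext => x; rewrite derive1_dilate.
move=> x; apply: cvgMl; apply: continuous_comp; last exact: cf.
exact: mulrr_continuous.
Qed.

Lemma output_dilate (R : realType) (f : R -> R) (k y0 : R) (T : \bar R)
    (Y : R -> R) : k != 0 ->
  output f y0 T Y -> output (fun x => f (x / k)) y0 T Y.
Proof.
move=> k0 [Y0 [X2 [cY cX2 dYX]]]; split => //.
exists (k \*: X2); split => //.
  by move=> t; apply: cvgZl_tmp; exact: cX2.
move=> t t0 tT; have [dY dX] := dYX t t0 tT; split.
  by rewrite /= [k *: _]mulrC mulfK.
by apply: is_derive_eq; rewrite /= scalerAr.
Qed.

Lemma same_outputs_dilate (R : realType) (f : R -> R) (k : R) : k != 0 ->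
  same_outputs f (fun x => f (x / k)).
Proof.
move=> k0 y0 T Y _; split; first exact: output_dilate.
(* The converse is the same implication for the factor [k^-1], which undoes the first dilation. *)
move=> /(output_dilate (invr_neq0 k0)); congr output.
by apply/funext => x; rewrite invrK mulfK.
Qed.

(** The derivative has no zero in a punctured neighbourhood of the midpoint [m]: by local
    invertibility if it vanishes at [m], by continuity otherwise. Puncturing also avoids the point
    0, even when [m] is 0. *)
Lemma locally_invertible_derive1_neq0 (R : realType) (f : R -> R) (a b : R) :
  continuous (derive1 f) -> locally_invertible f -> a < b ->
  exists x, [/\ x \in `[a, b], x != 0 & derive1 f x != 0].
Proof.
move=> cf finv ab; have mab : (a + b) / 2 \in `]a, b[ by exact: mid_in_itvoo.
set m := (a + b) / 2 in mab.
have fm : \forall y \near m^', derive1 f y != 0.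
  have [/finv//|fm0] := eqVneq (derive1 f m) 0.
  by apply: nbhs_dnbhs; apply: (cvgr_neq0 _ (cf m)).
have m0 : \forall y \near m^', y != 0.
  have [->|m0] := eqVneq m 0; first exact: nbhs_dnbhs_neq.
  by apply: nbhs_dnbhs; apply: (cvgr_neq0 _ (@cvg_id _ (nbhs m))).
have mab' : \forall y \near m^', y \in `]a, b[.
  by apply: nbhs_dnbhs; exact: near_in_itvoo.
have [x [[? ?] ?]] := filter_ex (filterI (filterI fm m0) mab').
by exists x; split => //; exact: subset_itv_oo_cc.
Qed.

(** The factor is written [h + 1] so that [h] is also the increment in the difference quotient at 1
    of [s |-> f (s * x0)]. *)
Definition dilation_stable (R : realType) (D : set R) (f : R -> R) : Prop :=
  forall e : R, 0 < e ->
    \forall h \near (0 : R), forall x, D x -> `|f (x * (h + 1)) - f x| < e.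

(** The difference is jointly continuous in [x] and [h] and vanishes at [h = 0], so it is small near
    each [(x, 0)]; compactness makes the range of [h] uniform in [x]. *)
Lemma dilation_stable_compact (R : realType) (D : set R) (f : R -> R) :
  continuous f -> compact D -> dilation_stable D f.
Proof.
move=> cf cD e e0.
apply: ((compact_near_coveringP D).1 cD R (nbhs (0 : R))
  (fun h x => `|f (x * (h + 1)) - f x| < e)) => x Dx.
have c1 : z.1 * (z.2 + 1) @[z --> (x, 0 : R)] --> x * (0 + 1).
  apply: cvgM; first exact: cvg_fst.
  by apply: cvgD; [exact: cvg_snd|exact: cvg_cst].
rewrite add0r mulr1 in c1.
have : f (z.1 * (z.2 + 1)) - f z.1 @[z --> (x, 0 : R)] --> f x - f x.
  apply: cvgB; first by apply: continuous_cvg; [exact: cf|exact: c1].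
  by apply: continuous_cvg; [exact: cf|exact: cvg_fst].
by rewrite subrr => /cvgr0Pnorm_lt /(_ e e0).
Qed.

Lemma dilation_stable_setT (R : realType) (f : R -> R) : continuous f ->
  cvg (f x @[x --> +oo]) -> cvg (f x @[x --> -oo]) -> dilation_stable setT f.
Proof.
move=> cf cp cn e e0.
have e2 : 0 < e / 2 by rewrite divr_gt0.
have [p fp] : exists p, forall x, p < x ->
    `|lim (f x @[x --> +oo]) - f x| < e / 2.
  by have /cvgrPdist_lt /(_ _ e2) [p [_ fp]] := cp; exists p.
have [n fn] : exists n, forall x, x < n ->
    `|lim (f x @[x --> -oo]) - f x| < e / 2.
  by have /cvgrPdist_lt /(_ _ e2) [n [_ fn]] := cn; exists n.
have tri (l u v : R) : `|l - u| < e / 2 -> `|l - v| < e / 2 -> `|u - v| < e.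
  move=> lu lv; rewrite (splitr e); apply: (le_lt_trans (ler_distD l _ _)).
  by rewrite ltrD// distrC.
(* Beyond [M] on either side, [f] is within [e / 2] of its limit there. If [x] lies outside the
   segment of radius [2 * M] and [h] is below 1/2 in absolute value, then [x] and [x * (h + 1)] are
   both beyond [M] on the same side. *)
pose M := `|p| + `|n|.
have := dilation_stable_compact cf (@segment_compact R (- (2 * M)) (2 * M)) e0.
have h12 : \forall h \near (0 : R), `|h| < 1 / 2.
  by apply: nbhs0_lt; rewrite divr_gt0.
apply: filterS2 h12 => h h12 hM x _.
have M0 : 0 <= M by rewrite addr_ge0.
have pM : p <= M by rewrite (le_trans (ler_norm p))// lerDl.
have nM : - M <= n by rewrite lerNl (le_trans (ler_norm (- n)))// normrN lerDr.
have [xM|Mx] := lerP x (2 * M); last first.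
  apply: (tri (lim (f x @[x --> +oo]))); apply: fp;
    last by apply: (le_lt_trans pM); nra.
  by apply: (le_lt_trans pM); move: h12; rewrite ltr_norml => /andP[]; nra.
have [Mx|xM'] := lerP (- (2 * M)) x.
  by apply: hM; rewrite /= in_itv /= Mx.
apply: (tri (lim (f x @[x --> -oo]))); apply: fn;
  last by apply: (lt_le_trans _ nM); nra.
by apply: (lt_le_trans _ nM); move: h12; rewrite ltr_norml => /andP[]; nra.
Qed.

Lemma globally_locally_identifiable (R : realType) (D : set R) (f : R -> R) :
  globally_identifiable D f -> locally_identifiable D f.
Proof. by move=> gf; exists 1 => // g ag fg _; exact: gf. Qed.

Lemma dilation_stable_nonidentifiable (R : realType) (D : set R) (f : R -> R)
    (x0 : R) :
  admissible f -> dilation_stable D f -> D x0 -> x0 != 0 -> derive1 f x0 != 0 ->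
  structurally_nonidentifiable D f.
Proof.
move=> af sf Dx0 x00 fx0; suff nl : ~ locally_identifiable D f.
  by split=> // /globally_locally_identifiable.
move=> [e e0 idf]; have [df _] := af.
have df' : derive1 (fun s : R => f (s * x0)) 1 != 0.
  by rewrite derive1_dilate// mul1r mulf_neq0.
have ne := derive1_neq0_near (derivable_dilate (df (1 * x0))) df'.
(* Pointwise strict bounds give only a weak bound on the supremum; [e / 2] keeps it strictly below
   [e]. *)
have se := nbhs_dnbhs (sf (e / 2) (divr_gt0 e0 (ltr0n _ 2))).
have n1 : \forall h \near (0 : R)^', h + 1 != 0.
  apply: nbhs_dnbhs; have c1 : h + 1 @[h --> (0 : R)] --> (0 : R) + 1.
    by apply: cvgD; [exact: cvg_id|exact: cvg_cst].
  by apply: (cvgr_neq0 _ c1); rewrite add0r oner_neq0.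
have [h [[hne hse] h1]] := filter_ex (filterI (filterI ne se) n1).
have k0 := invr_neq0 h1.
have := idf _ (admissible_dilate _ af) (same_outputs_dilate f k0) _ x0 Dx0.
rewrite invrK => hf; move/eqP: hne; apply; rewrite mul1r mulrC; apply: hf.
apply: (@le_lt_trans _ _ (e / 2)%:E); last first.
  by rewrite lte_fin ltr_pdivrMr// mulr_natr mulr2n ltrDl.
by apply: ge_ereal_sup => _ [x Dx <-]; rewrite lee_fin ltW//; exact: hse.
Qed.

Theorem proposition5p2 (R : realType) (f1 : R -> R)
    (f1_adm : admissible f1) (f1_inv : locally_invertible f1) :
  [/\ forall k : R, k != 0 ->
        admissible (fun x : R => f1 (x / k)) /\
        same_outputs f1 (fun x : R => f1 (x / k)),
      ~ globally_identifiable setT f1,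
      forall a b : R, a < b -> structurally_nonidentifiable `[a, b]%classic f1 &
      cvg (f1 x @[x --> +oo]) -> cvg (f1 x @[x --> -oo]) ->
        structurally_nonidentifiable setT f1].
Proof.
have [df cf'] := f1_adm.
have cf : continuous f1.
  by move=> x; apply/differentiable_continuous/derivable1_diffP.
have nonid a b : a < b -> structurally_nonidentifiable `[a, b]%classic f1.
  move=> /(locally_invertible_derive1_neq0 cf' f1_inv)[x [xab x0 fx]].
  apply: (dilation_stable_nonidentifiable _ _ xab x0 fx) => //.
  by apply: dilation_stable_compact => //; exact: segment_compact.
split=> //.
- by move=> k k0; split; [exact: admissible_dilate|exact: same_outputs_dilate].
(* Identifiability on the whole line would restrict to the segment from 0 to 1. *)
- by move=> gf; case: (nonid 0 1 ltr01) => + _; apply=> g ag fg x _; exact: gf.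
- move=> cp cn.
  have [x [_ x0 fx]] := locally_invertible_derive1_neq0 cf' f1_inv (@ltr01 R).
  apply: (dilation_stable_nonidentifiable _ _ _ x0 fx) => //.
  exact: dilation_stable_setT.
Qed.
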